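(* Let $d\ge1$ and for each $i=1,\dots,d$ let $(\mathcal{S}^{(i)}_m)_{m\ge1}$ be a family of one-dimensional pseudospectral operators, with $\mathcal{S}^{(i)}_0=0$. Suppose that each $\mathcal{S}^{(i)}_m$, $m\ge1$, has no internal aliasing, that the exact sets are nested ($\mathcal{E}(\mathcal{S}^{(i)}_m)\subseteq\mathcal{E}(\mathcal{S}^{(i)}_{m'})$ for all $i$ and all $1\le m\le m'$), and that $\mathcal{K}\subset\mathbb{N}_0^d$ is a finite admissible multi-index set. Then the Smolyak pseudospectral operator $A(\mathcal{K},d,\mathcal{S})$ has no internal aliasing: for all $\Psi_{\mathbf{j}},\Psi_{\mathbf{j}'}$ included in its expansion, the coefficient of $\Psi_{\mathbf{j}}$ in $A(\mathcal{K},d,\mathcal{S})(\Psi_{\mathbf{j}'})$ equals $1$ if $\mathbf{j}=\mathbf{j}'$ and $0$ otherwise.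
   Context: For $i=1,\dots,d$: $X^{(i)}\subseteq\mathbb{R}$ is an interval, $w^{(i)}:X^{(i)}\to\mathbb{R}^+$ an integrable weight normalized to a probability density, with all polynomials integrable against it; $\mathcal{I}^{(i)}(f)=\int_{X^{(i)}}f(x)w^{(i)}(x)\,dx$, and $\{\psi^{(i)}_j\}_{j\ge0}$ are the orthonormal polynomials ($\deg\psi^{(i)}_j=j$) for $\langle f,g\rangle=\mathcal{I}^{(i)}(fg)$. One-dimensional pseudospectral operators: for $m\ge1$, given a quadrature rule $\mathcal{Q}^{(i)}_m(f)=\sum_{j=1}^{p^{(i)}(m)}w^{(i)}_jf(x^{(i)}_j)$ approximating $\mathcal{I}^{(i)}$ and a truncation degree $q^{(i)}(m)\in\mathbb{N}_0$, $\mathcal{S}^{(i)}_m(f):=\sum_{j=0}^{q^{(i)}(m)}\mathcal{Q}^{(i)}_m(f\psi^{(i)}_j)\,\psi^{(i)}_j$. The operator $\mathcal{S}^{(i)}_m$ has no internal aliasing if $\mathcal{Q}^{(i)}_m(\psi^{(i)}_j\psi^{(i)}_k)=\delta_{jk}$ for all $0\le j,k\le q^{(i)}(m)$ (equivalently $\mathcal{S}^{(i)}_m$ reproduces every polynomial of degree at most $q^{(i)}(m)$). The operators $\mathcal{S}^{(i)}_m$ approximate the identity (the limit, as $n\to\infty$, of orthogonal projection onto polynomials of degree at most $n$), so the exact set is $\mathcal{E}(\mathcal{S}^{(i)}_m)=\{f:\mathcal{S}^{(i)}_m(f)=f\}$. Tensor versions: $\Psi_{\mathbf{j}}(\mathbf{x})=\prod_{i=1}^d\psi^{(i)}_{j_i}(x^{(i)})$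 for $\mathbf{j}\in\mathbb{N}_0^d$ and $\mathcal{S}^{(\mathbf{d})}_{\mathbf{k}}=\mathcal{S}^{(1)}_{k_1}\otimes\cdots\otimes\mathcal{S}^{(d)}_{k_d}$. Admissibility: a set $\mathcal{K}\subseteq\mathbb{N}_0^d$ is admissible if for every $\mathbf{k}\in\mathcal{K}$ and every $i$ with $\mathbf{k}-\mathbf{e}_i\in\mathbb{N}_0^d$ ($\mathbf{e}_i$ the $i$-th canonical unit vector), $\mathbf{k}-\mathbf{e}_i\in\mathcal{K}$. Smolyak pseudospectral operator: with $\Delta^{(i)}_0:=\mathcal{S}^{(i)}_0=0$ and $\Delta^{(i)}_n:=\mathcal{S}^{(i)}_n-\mathcal{S}^{(i)}_{n-1}$ for $n\ge1$, $A(\mathcal{K},d,\mathcal{S}):=\sum_{\mathbf{k}\in\mathcal{K}}\Delta^{(1)}_{k_1}\otimes\cdots\otimes\Delta^{(d)}_{k_d}$. The term $\Psi_{\mathbf{j}}$ is included in its expansion if and only if there is $\mathbf{k}\in\mathcal{K}$ with all $k_i\ge1$ and $j_i\le q^{(i)}(k_i)$ for all $i$. *)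

(* Defs.v *)
From HB Require Import structures.
From mathcomp Require Export all_boot all_order all_algebra finmap.
From mathcomp Require Export all_classical all_reals all_analysis.

Set Implicit Arguments.
Unset Strict Implicit.
Unset Printing Implicit Defensive.

Export Order.TTheory GRing.Theory Num.Theory.
Export numFieldNormedType.Exports.

Local Open Scope classical_set_scope.
Local Open Scope ring_scope.

(* Functions on an interval X : set R are functions on the subtype X, so that
   equality of functions is equality on X. Weights are functions on R whose
   values outside X are irrelevant. *)

Section OneDim.
Context {R : realType} (X : set R).
Implicit Types (w : R -> R) (psi : nat -> {poly R}).

Record probability_weight w : Prop := ProbabilityWeight {
  pw_pos : forall x, X x -> 0 < w x ;
  pw_integrable : lebesgue_measure.-integrable X (EFin \o w) ;
  pw_normalized : (\int[lebesgue_measure]_(x in X) (w x)%:E = 1)%E ;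
  pw_poly_integrable : forall p : {poly R},
    lebesgue_measure.-integrable X (fun x => (p.[x] * w x)%:E) }.

Definition weighted_integral w (f : R -> R) : R :=
  \int[lebesgue_measure]_(x in X) (f x * w x).

Definition orthonormal_polynomials w psi : Prop :=
  (forall j, size (psi j) = j.+1) /\
  (forall j k,
    weighted_integral w (fun x => (psi j).[x] * (psi k).[x]) = (j == k)%:R).

Record quadrature := Quadrature {
  qsize : nat ;
  qnode : 'I_qsize -> X ;
  qweight : 'I_qsize -> R }.

Definition quad (Q : quadrature) (f : X -> R) : R :=
  \sum_(a < qsize Q) qweight a * f (qnode a).

Definition peval (p : {poly R}) : X -> R := fun x => p.[val x].

Definition pseudospectral psi (Q : quadrature) (q : nat) (f : X -> R) : X -> R :=
  fun x => \sum_(j < q.+1)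
    quad Q (fun y => f y * peval (psi j) y) * peval (psi j) x.

(* The family S_0, S_1, ...; since S_0 = 0, the values Q 0 and q 0 are unused. *)
Definition pseudospectral_family psi (Q : nat -> quadrature) (q : nat -> nat)
    (m : nat) : (X -> R) -> (X -> R) :=
  if m is 0%N then fun _ _ => 0 else pseudospectral psi (Q m) (q m).

Definition no_internal_aliasing psi (Q : quadrature) (q : nat) : Prop :=
  forall j k, (j <= q)%N -> (k <= q)%N ->
    quad Q (fun y => peval (psi j) y * peval (psi k) y) = (j == k)%:R.

Definition exact_set (S : (X -> R) -> (X -> R)) : set (X -> R) :=
  [set f | S f = f].

Definition smolyak_diff (S : nat -> (X -> R) -> (X -> R)) (n : nat) :
    (X -> R) -> (X -> R) :=
  if n is m.+1 then fun f x => S m.+1 f x - S m f x else S 0%N.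

End OneDim.

Arguments quadrature {R} X.

Definition multi_index (d : nat) := {ffun 'I_d -> nat}.

Definition multi_pred (d : nat) (k : multi_index d) (i : 'I_d) : multi_index d :=
  [ffun l => (k l - (l == i))%N].

(* k - e_i lies in N^d exactly when k_i > 0. *)
Definition admissible (d : nat) (K : {fset multi_index d}) : Prop :=
  forall k, k \in K -> forall i, (0 < k i)%N -> multi_pred k i \in K.

Section Tensor.
Context {R : realType} {d : nat} (X : 'I_d -> set R).

Definition point := forall i, X i.

(* T acting on the i-th variable, the other variables being frozen. *)
Definition on_coord (i : 'I_d) (T : (X i -> R) -> (X i -> R))
    (F : point -> R) : point -> R :=
  fun x => T (fun y => F (eqtype.dfwith x y)) (x i).

(* T_1 (x) ... (x) T_d as the composition of the T_i, each acting on its own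
   variable: for linear T_i it maps prod_i f_i(x_i) to prod_i (T_i f_i)(x_i).
   The order of composition is irrelevant for the operators used here, which
   are finite sums f |-> sum_a f(x_a) g_a. *)
Definition tensor_op (T : forall i, (X i -> R) -> (X i -> R)) :
    (point -> R) -> (point -> R) :=
  \big[(fun U V => U \o V)/id]_(i < d) on_coord (T i).

Definition smolyak (K : {fset multi_index d})
    (S : forall i, nat -> (X i -> R) -> (X i -> R))
    (F : point -> R) : point -> R :=
  fun x => \sum_(k <- K) tensor_op (fun i => smolyak_diff (S i) (k i)) F x.

Variable psi : 'I_d -> nat -> {poly R}.

Definition Psi (j : multi_index d) : point -> R :=
  fun x => \prod_(i < d) peval (psi i (j i)) (x i).

Definition expansion (F : point -> R) (c : {fsfun multi_index d -> R with 0}) :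
    Prop :=
  F = fun x => \sum_(j <- finsupp c) c j * Psi j x.

(* "The coefficient of Psi_j in F is a": F is a finite linear combination of
   the Psi's, and a is its (well-determined) coefficient at j. *)
Definition is_coefficient (F : point -> R) (j : multi_index d) (a : R) : Prop :=
  (exists c, expansion F c) /\ (forall c, expansion F c -> c j = a).

Definition included (K : {fset multi_index d}) (q : 'I_d -> nat -> nat)
    (j : multi_index d) : Prop :=
  exists2 k, k \in K & forall i, (1 <= k i)%N && (j i <= q i (k i))%N.

Definition smolyak_no_internal_aliasing (K : {fset multi_index d})
    (Q : forall i, nat -> quadrature (X i)) (q : 'I_d -> nat -> nat) : Prop :=
  forall j j', included K q j -> included K q j' ->
    is_coefficient
      (smolyak K (fun i => pseudospectral_family (psi i) (Q i) (q i)) (Psi j'))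
      j (j == j')%:R.

End Tensor.

(* Main.v *)
(* If Psi_j is included through k in K, nestedness makes S_m reproduce psi_(j_i)
   for every m >= k_i, so Delta_m psi_(j_i) = 0 for m > k_i. Hence only the
   terms l <= k of A(K) act on Psi_j; admissibility puts all of them in K, and
   they telescope: A(K) Psi_j = (x)_i S_(k_i) psi_(j_i) = Psi_j. It remains to see
   that the coefficients of an expansion are well defined. Since w has integral
   1, each X^(i) is infinite, so finitely many point evaluations on X^(i) combine
   to a functional dual to psi_0, ..., psi_N, and products of such functionals
   read off coefficients. *)
Require Import Defs.

Set Implicit Arguments.
Unset Strict Implicit.
Unset Printing Implicit Defensive.

Local Open Scope classical_set_scope.
Local Open Scope ring_scope.

(** * One-dimensional operators and dual functionals *)

Section OneDim.
Context {R : realType} (X : set R).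
Implicit Types (psi : nat -> {poly R}) (Q : quadrature X) (f : X -> R).

(** A finite set is Lebesgue-null, so the integral of [w] over it would be 0 instead of 1. *)
Lemma probability_weight_infinite (w : R -> R) :
  probability_weight X w -> infinite_set X.
Proof.
case=> _ w_int w_norm _ /finite_set_countable X_cnt.
have X_meas : measurable X by exact: countable_measurable.
move: w_norm; rewrite null_set_integral //.
- by move=> /esym/eqP; rewrite onee_eq0.
- exact: measurable_int w_int.
- exact: countable_lebesgue_measure0.
Qed.

Lemma infinite_set_nodes (n : nat) :
  infinite_set X -> exists2 t : 'I_n -> R, injective t & forall a, X (t a).
Proof.
move=> /infinite_set_fset -/(_ n)[B BX nB].
exists (fun a => nth 0 (enum_fset B) a) => [a b /eqP|a].
  rewrite nth_uniq ?fset_uniq // ?(leq_trans (ltn_ord _)) //.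
  by move/eqP; exact: val_inj.
by apply: BX; rewrite /= mem_nth // (leq_trans (ltn_ord a)).
Qed.

(* The collocation matrix psi_j(t_a) is a triangular matrix of coefficients
   times a Vandermonde matrix, hence invertible. *)
Lemma exists_dual_nodes psi (N : nat) :
  infinite_set X -> (forall j, size (psi j) = j.+1) ->
  exists t : 'I_N.+1 -> X,
    forall k, (k <= N)%N -> exists l : 'I_N.+1 -> R,
      forall j, (j <= N)%N -> \sum_a l a * peval (psi j) (t a) = (j == k)%:R.
Proof.
move=> X_inf size_psi; have [t t_inj Xt] := infinite_set_nodes N.+1 X_inf.
pose t' a : X := exist _ (t a) (mem_set (Xt a)).
exists t' => // k kN.
pose B : 'M[R]_N.+1 := \matrix_(j, c) (psi j)`_c.
pose V : 'M[R]_N.+1 := Vandermonde N.+1 (\row_a t a).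
have B_unit : B \in unitmx.
  rewrite unitmxE det_trig; last first.
    apply/is_trig_mxP => i j ij.
    by rewrite mxE nth_default // size_psi.
  rewrite unitfE; apply/prodf_neq0 => i _.
  (* The diagonal entry is the leading coefficient of [psi i], because the index [i] is the size
     minus one. *)
  rewrite mxE -[X in _`_X]/(i.+1.-1) -(size_psi i) -/(lead_coef (psi i)).
  by rewrite lead_coef_eq0 -size_poly_eq0 size_psi.
have V_unit : V \in unitmx.
  rewrite unitmxE det_Vandermonde unitfE.
  apply/prodf_neq0 => i _; apply/prodf_neq0 => j ij.
  rewrite !mxE subr_eq0; apply/eqP => /t_inj eq_ij.
  by rewrite eq_ij ltnn in ij.
have BV j a : (B *m V) j a = peval (psi j) (t' a).
  rewrite /peval /= (@horner_coef_wide _ N.+1) ?size_psi ?ltn_ord //.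
  by rewrite mxE; apply: eq_bigr => c _; rewrite !mxE.
have BV_unit : B *m V \in unitmx by rewrite unitmx_mul B_unit.
(* The weights dual to [psi k] form column [k] of the inverse collocation matrix. *)
exists (fun a => invmx (B *m V) a (inord k)) => j jN.
have /matrixP/(_ (inord j) (inord k)) := mulmxV BV_unit.
rewrite mxE [RHS]mxE -val_eqE /= !inordK // => <-.
by apply: eq_bigr => a _; rewrite BV inordK // mulrC.
Qed.

(** An operator in one variable sees the factors of a product function in the other variables as a
    constant; this property lets that constant pass through. *)
Definition homogeneous (T : (X -> R) -> (X -> R)) : Prop :=
  forall c f, T (fun y => c * f y) = fun x => c * T f x.

Lemma pseudospectral_family_homogeneous psi (Q : nat -> quadrature X) q m :
  homogeneous (pseudospectral_family psi Q q m).
Proof.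
move=> c f; apply/funext => x; case: m => [|m] /=; first by rewrite mulr0.
rewrite /pseudospectral mulr_sumr; apply: eq_bigr => j _.
rewrite mulrA /quad mulr_sumr; congr (_ * _).
by apply: eq_bigr => a _; rewrite -mulrA mulrCA.
Qed.

Lemma smolyak_diff_homogeneous (S : nat -> (X -> R) -> (X -> R)) n :
  (forall m, homogeneous (S m)) -> homogeneous (smolyak_diff S n).
Proof.
move=> S_hom c f; case: n => [|n] /=; first exact: S_hom.
by apply/funext => x; rewrite !S_hom mulrBr.
Qed.

Lemma sum_smolyak_diff (S : nat -> (X -> R) -> (X -> R)) n f x :
  \sum_(a < n.+1) smolyak_diff S a f x = S n f x.
Proof.
elim: n => [|n IHn]; first by rewrite big_ord1.
by rewrite big_ord_recr IHn /= addrC subrK.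
Qed.

Lemma pseudospectral_basis psi Q q j :
  no_internal_aliasing psi Q q -> (j <= q)%N ->
  pseudospectral psi Q q (peval (psi j)) = peval (psi j).
Proof.
move=> alias jq; apply/funext => x.
rewrite /pseudospectral (bigD1 (Ordinal (jq : (j < q.+1)%N))) //=.
rewrite alias // eqxx mul1r big1 ?addr0 // => i ij.
rewrite alias //; last by rewrite -ltnS.
by rewrite eq_sym (negPf (ij : i != j :> nat)) mul0r.
Qed.

End OneDim.

(** * Admissible multi-index sets *)

Lemma admissible_leq d (K : {fset multi_index d}) (k l : multi_index d) :
  admissible K -> k \in K -> (forall i, (l i <= k i)%N) -> l \in K.
Proof.
(* Descend from [k] to [l] by unit steps that stay in [K] and above [l]; each step lowers the
   distance [\sum_i (k i - l i)], on which the induction runs. *)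
move=> K_adm; have [n] := ubnP (\sum_i (k i - l i)).
elim: n k => // n IHn k; rewrite ltnS => le_n kK lk.
have [->//|/eqP l_neq_k] := eqVneq l k.
have [i lt_i] : exists i, (l i < k i)%N.
  apply: contrapT => no_lt; apply: l_neq_k; apply/ffunP => i.
  by apply/eqP; rewrite eqn_leq lk leqNgt; apply/negP => ?; apply: no_lt; exists i.
apply: (IHn (multi_pred k i)).
- apply: leq_trans le_n; rewrite [X in (_ < X)%N](bigD1 i) //= (bigD1 i) //=.
  rewrite ffunE eqxx subn1 -addSn leq_add //.
    by rewrite -subn1 subnAC subn1 prednK // subn_gt0.
  by apply: leq_sum => m _; rewrite ffunE leq_sub2r // leq_subr.
- by apply: K_adm => //; exact: leq_ltn_trans lt_i.
- move=> m; rewrite ffunE; case: eqVneq => [->|_]; last by rewrite subn0.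
  by rewrite subn1 -ltnS prednK // (leq_ltn_trans _ lt_i).
Qed.

(** Encloses a finite index set in a cube, over which sums of products factor coordinatewise. *)
Lemma leq_max_entry d (K : {fset multi_index d}) (l : multi_index d) i :
  l \in K -> (l i <= \max_(k <- K) \max_m k m)%N.
Proof.
by move=> lK; apply: leq_trans (leq_bigmax_seq _ lK isT); exact: (leq_bigmax i).
Qed.

(** * Tensor operators and the Smolyak sum on product functions *)

Section Tensor.
Context {R : realType} {d : nat} (X : 'I_d -> set R).

Lemma tensor_op_prod (T : forall i, (X i -> R) -> (X i -> R))
    (f : forall i, X i -> R) :
  (forall i, homogeneous (@T i)) ->
  tensor_op T (fun x => \prod_i f i (x i)) = fun x => \prod_i T i (f i) (x i).
Proof.
move=> T_hom; rewrite /tensor_op.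
(* Induction on partial compositions: after the coordinates in [s], exactly those factors are
   transformed. Absence of repetitions ensures that each [T i] meets the original [f i]. *)
suff step (s : seq 'I_d) : uniq s ->
    (\big[(fun U V => U \o V)/id]_(i <- s) on_coord (T i))
      (fun x : point X => \prod_i f i (x i)) =
    fun x => \prod_i (if i \in s then T i (f i) else f i) (x i).
  rewrite step ?index_enum_uniq //; apply/funext => x.
  by apply: eq_bigr => i _; rewrite mem_index_enum.
elim: s => [_|i s IHs /= /andP[iNs s_uniq]].
  by rewrite big_nil.
rewrite big_cons /= IHs //; apply/funext => x.
rewrite /on_coord.
transitivity (T i (fun y => (\prod_(m | m != i)
    (if m \in s then T m (f m) else f m) (x m)) * f i y) (x i)).
  congr (T i _ _); apply/funext => y.
  rewrite (bigD1 i) //= (negPf iNs) eqtype.dfwith_in mulrC; congr (_ * _).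
  by apply: eq_bigr => m mi; rewrite eqtype.dfwith_out // eq_sym.
rewrite T_hom [RHS](bigD1 i) //= mem_head mulrC; congr (_ * _).
by apply: eq_bigr => m mi; rewrite in_cons (negPf mi).
Qed.

Variable psi : 'I_d -> nat -> {poly R}.

Lemma smolyak_Psi (K : {fset multi_index d})
    (Q : forall i, nat -> quadrature (X i)) (q : 'I_d -> nat -> nat) (j : multi_index d) :
  (forall i m, (1 <= m)%N -> no_internal_aliasing (psi i) (Q i m) (q i m)) ->
  (forall i m m', (1 <= m)%N -> (m <= m')%N ->
    exact_set (pseudospectral_family (psi i) (Q i) (q i) m) `<=`
    exact_set (pseudospectral_family (psi i) (Q i) (q i) m')) ->
  admissible K -> included K q j ->
  smolyak K (fun i => pseudospectral_family (psi i) (Q i) (q i)) (Psi psi j)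
    = Psi psi j.
Proof.
move=> alias nested K_adm [k kK k_incl].
pose S i := pseudospectral_family (psi i) (Q i) (q i).
have S_exact i m : (k i <= m)%N ->
    S i m (peval (psi i (j i))) = peval (psi i (j i)).
  have /andP[k_gt0 j_le] := k_incl i => km.
  apply: (nested i (k i) m k_gt0 km).
  rewrite /exact_set /= /pseudospectral_family.
  case: (k i) k_gt0 j_le => // n _ j_le.
  exact: pseudospectral_basis (alias i n.+1 isT) j_le.
have D0 i m x : (k i < m)%N -> smolyak_diff (S i) m (peval (psi i (j i))) x = 0.
  case: m => // m; rewrite ltnS => km.
  by rewrite /smolyak_diff !S_exact ?subrr // leqW.
apply/funext => x; rewrite /smolyak.
pose F (l : multi_index d) : R :=
  \prod_i smolyak_diff (S i) (l i) (peval (psi i (j i))) (x i).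
transitivity (\sum_(l <- K) F l).
  apply: eq_bigr => l _; rewrite (tensor_op_prod (fun i => peval (psi i (j i)))) // => i.
  by apply: smolyak_diff_homogeneous => m; exact: pseudospectral_family_homogeneous.
(* If [l] were below [k] in every coordinate, admissibility would put it in [K]; so some [l i]
   exceeds [k i], and that factor vanishes. *)
have F0 l : l \notin K -> F l = 0.
  move=> lK; apply/eqP/prodf_eq0.
  suff [i lt_i] : exists i, (k i < l i)%N by exists i => //; rewrite D0.
  apply: contrapT => no_lt; case/negP: lK.
  apply: (admissible_leq K_adm kK) => i.
  by rewrite leqNgt; apply/negP => ?; apply: no_lt; exists i.
pose N := (\max_(l <- K) \max_i l i)%N.
have le_N l i : l \in K -> (l i <= N)%N.
  exact: leq_max_entry.
(* [K] is enlarged to the full cube of side 0..N, which adds only zero terms and makes the sum a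
   product of one-dimensional sums. *)
pose emb (g : {ffun 'I_d -> 'I_N.+1}) : multi_index d := [ffun i => g i : nat].
have emb_inj : injective emb.
  move=> g h /ffunP gh; apply/ffunP => i; apply: val_inj.
  by have := gh i; rewrite !ffunE.
pose box := imfset imfset_key emb (mem [set: {ffun 'I_d -> 'I_N.+1}]%SET).
rewrite (@big_fset_incl _ _ _ _ K box) /=; last first.
- by move=> l _; exact: F0.
- apply/fsubsetP => l lK; apply/imfsetP.
  exists [ffun i => inord (l i)]; rewrite ?inE //.
  by apply/ffunP => i; rewrite !ffunE inordK // ltnS le_N.
rewrite big_imfset /=; last by move=> g h _ _; exact: emb_inj.
transitivity (\sum_(g : {ffun 'I_d -> 'I_N.+1}) F (emb g)).
  by rewrite big_enum; apply: eq_bigl => g; rewrite inE.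
transitivity (\prod_i \sum_(a < N.+1)
    smolyak_diff (S i) a (peval (psi i (j i))) (x i)).
  rewrite bigA_distr_bigA; apply: eq_bigr => g _.
  by apply: eq_bigr => i _; rewrite ffunE.
(* Each sum telescopes to [S i N], which is exact here since [k] in [K] gives [k i <= N]. *)
by apply: eq_bigr => i _; rewrite sum_smolyak_diff S_exact // le_N.
Qed.

(** * Uniqueness of coefficients *)

Hypothesis X_inf : forall i, infinite_set (X i).
Hypothesis size_psi : forall i j, size (psi i j) = j.+1.

Lemma expansion_Psi (j' : multi_index d)
    (c : {fsfun multi_index d -> R with 0}) :
  expansion psi (Psi (X := X) psi j') c -> forall j, c j = (j == j')%:R.
Proof.
move=> expn j.
(* [J] holds every index that will be tested, so one degree bound [N] serves them all. *)
pose J := (j |` (j' |` finsupp c))%fset.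
pose N := (\max_(l <- J) \max_i l i)%N.
have le_N l i : l \in J -> (l i <= N)%N.
  exact: leq_max_entry.
have dual i : {tl : ('I_N.+1 -> X i) * ('I_N.+1 -> R) | forall m, (m <= N)%N ->
    \sum_a tl.2 a * peval (psi i m) (tl.1 a) = (m == j i)%:R}.
  apply: cid; have [t t_dual] := exists_dual_nodes N (@X_inf i) (@size_psi i).
  have [|l l_dual] := t_dual (j i); last by exists (t, l).
  by apply: le_N; rewrite !inE eqxx.
pose t i := (sval (dual i)).1; pose l i := (sval (dual i)).2.
(* The tensor product of the functionals dual to degree [j i] in coordinate [i]: among the
   [Psi psi m] with [m] in [J], it detects only [m = j]. *)
pose L (G : point X -> R) : R := \sum_(g : {ffun 'I_d -> 'I_N.+1})
  (\prod_i l i (g i)) * G (fun i => t i (g i)).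
have L_Psi m : m \in J -> L (Psi psi m) = (m == j)%:R.
  move=> mJ; transitivity (\prod_i \sum_a l i a * peval (psi i (m i)) (t i a)).
    by rewrite bigA_distr_bigA; apply: eq_bigr => g _; rewrite big_split.
  rewrite (eq_bigr (fun i => (m i == j i)%:R)); last first.
    by move=> i _; rewrite (svalP (dual i)) // le_N.
  have [->|m_neq] := eqVneq m j; first by rewrite big1 // => i _; rewrite eqxx.
  apply/eqP/prodf_eq0.
  suff [i mi] : exists i, m i != j i by exists i; rewrite ?(negPf mi).
  apply: contrapT => no_neq; case/eqP: m_neq; apply/ffunP => i.
  by apply: contrapT => /eqP mi; apply: no_neq; exists i.
have := congr1 L expn; rewrite L_Psi ?inE ?eqxx ?orbT //.
rewrite eq_sym => ->.
transitivity (\sum_(m <- finsupp c) c m * L (Psi psi m)); last first.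
  rewrite /L; under eq_bigr do rewrite mulr_sumr.
  rewrite exchange_big; apply: eq_bigr => g _ /=.
  by rewrite mulr_sumr; apply: eq_bigr => m _; rewrite mulrCA.
(* Off the support, [c j] is the default 0 and every term vanishes; on it, only the term [m = j]
   survives. *)
have [j_supp|j_supp] := boolP (j \in finsupp c); last first.
  rewrite (fsfun_dflt j_supp) big_seq big1 // => m m_supp.
  rewrite L_Psi ?inE ?m_supp ?orbT //; case: eqVneq m_supp => [->|_ _].
    by rewrite (negPf j_supp).
  by rewrite mulr0.
rewrite (big_fsetD1 j) //= L_Psi ?inE ?eqxx // mulr1 big_seq big1 ?addr0 //.
move=> m; rewrite in_fsetD1 => /andP[mj m_supp].
by rewrite L_Psi ?inE ?m_supp ?orbT // (negPf mj) mulr0.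
Qed.

Lemma is_coefficient_Psi (j j' : multi_index d) :
  is_coefficient (X := X) psi (Psi psi j') j (j == j')%:R.
Proof.
split; last by move=> c /expansion_Psi ->.
exists [fsfun m in [fset j']%fset => 1 | 0].
(* The support is only known to lie inside the singleton of [j']; extending the sum to that
   singleton adds at most a zero term. *)
apply/funext => x; rewrite (big_fset_incl _ (finsupp_sub _ _ _)) /=.
  by rewrite big_seq_fset1 fsfunE inE eqxx mul1r.
by move=> m _ /fsfun_dflt ->; rewrite mul0r.
Qed.

End Tensor.

Theorem corollary3p4 (R : realType) (d : nat)
    (X : 'I_d -> set R) (w : 'I_d -> R -> R) (psi : 'I_d -> nat -> {poly R})
    (Q : forall i : 'I_d, nat -> quadrature (X i)) (q : 'I_d -> nat -> nat)
    (K : {fset multi_index d})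
    (d_ge1 : (1 <= d)%N)
    (X_itv : forall i, is_interval (X i))
    (w_weight : forall i, probability_weight (X i) (w i))
    (psi_orthonormal : forall i, orthonormal_polynomials (X i) (w i) (psi i))
    (S_no_aliasing : forall i m, (1 <= m)%N ->
      no_internal_aliasing (psi i) (Q i m) (q i m))
    (S_nested : forall i m m', (1 <= m)%N -> (m <= m')%N ->
      exact_set (pseudospectral_family (psi i) (Q i) (q i) m) `<=`
      exact_set (pseudospectral_family (psi i) (Q i) (q i) m'))
    (K_admissible : admissible K) :
  smolyak_no_internal_aliasing psi K Q q.
Proof.
move=> j j' _ j'_incl; rewrite smolyak_Psi //.
apply: is_coefficient_Psi => [i|i m].
  exact: probability_weight_infinite (w_weight i).
by have [->] := psi_orthonormal i.
Qed.
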